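(* There exists $n_0$ such that the following holds for every finite abelian group $G$ of even order $n\geq n_0$, every $A\subseteq G$, and every container family $\mathcal{F}$ of $A$ together with any fixed assignment defining the sets $\Phi(F_1,\dots,F_4)$ (see context). (a) If $B$ is the unique largest sum-free set of $G$ and $\kappa_4(A)>3.999^{n/2}$, then $|A\setminus B|<12n(\log n)^{-1/27}$. (b) If $G$ has at least two largest sum-free sets and $(F_1,\dots,F_4)\in\mathcal{F}^4$ satisfies $|\Phi(F_1,\dots,F_4)|>\left(3\sqrt2-\frac{1}{25}\right)^{n/2}$, then there exist largest sum-free sets $B_1,B_2$ and $B_3=B_1\triangle B_2$ of $G$ and a function $f:\{1,2,3,4\}\to\{1,2,3\}$ such that $|F_i\setminus B_{f(i)}|<3n(\log n)^{-1/27}$ for all $i\in\{1,\dots,4\}$, and the tuple $(B_{f(1)},\dots,B_{f(4)})$ consists of one $2$-atom and two $3$-atoms.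
   Context: Let $G$ be a finite abelian group of order $n$. A set is sum-free if it contains no (not necessarily distinct) $a,b,c$ with $a+b=c$ (a Schur triple); a largest sum-free set is a sum-free set of maximum size. For $A\subseteq G$, $\Phi_r(A)$ is the set of sum-free $r$-colorings of $A$, i.e. maps $\varphi:A\to\{1,\dots,r\}$ with every $\varphi^{-1}(i)$ sum-free, and $\kappa_r(A)=|\Phi_r(A)|$. A container family of $A$ is a family $\mathcal{F}$ of subsets of $A$ such that (1) $\log_2|\mathcal{F}|\leq n(\log n)^{-1/18}$; (2) every sum-free set $I\subseteq A$ is contained in some $F\in\mathcal{F}$; (3) every $F\in\mathcal{F}$ contains at most $n^2(\log n)^{-1/9}$ Schur triples. Given such $\mathcal{F}$, fix an assignment that maps each $\varphi\in\Phi_r(A)$ to a tuple $(F_1,\dots,F_r)\in\mathcal{F}^r$ with $\varphi^{-1}(i)\subseteq F_i$ for all $i$; $\Phi(F_1,\dots,F_r)$ denotes the set of $\varphi\in\Phi_r(A)$ assigned to $(F_1,\dots,F_r)$. For a largest sum-free set $B$ write $B^1=B$, $B^0=G\setminus B$. For a tuple $\mathcal{B}=(B_1,\dots,B_t)$ of largest sum-free sets and $\boldsymbol{\varepsilon}=(\varepsilon_1,\dots,\varepsilon_t)\in\{0,1\}^t$, the atom $\mathcal{B}(\boldsymbol{\varepsilon})=\bigcap_{i=1}^t B_i^{\varepsilon_i}$ is called a $k$-atom if $\sum_i\varepsilon_i=k$. The tuple $\mathcal{B}$ consists of a given collection of atoms if these atoms (nonempty) partition $\bigcup_{i} B_i$.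 *)

(* Defs.v *)
From mathcomp Require Import all_boot all_order all_algebra.
From mathcomp Require Import reals exp.

Set Implicit Arguments.
Unset Strict Implicit.
Unset Printing Implicit Defensive.

Import Order.TTheory GRing.Theory Num.Theory.
Local Open Scope ring_scope.

(* Ordered triples (a, b, c), entries not necessarily distinct. *)
Definition schur_triples (G : finZmodType) (S : {set G}) : {set G * G * G} :=
  [set t : G * G * G |
    [&& t.1.1 \in S, t.1.2 \in S, t.2 \in S & t.1.1 + t.1.2 == t.2]].

Definition sum_free (G : finZmodType) (S : {set G}) : bool :=
  schur_triples S == set0.

Definition largest_sum_free (G : finZmodType) (B : {set G}) : bool :=
  sum_free B && [forall S : {set G}, sum_free S ==> (#|S| <= #|B|)%N].

(* The colors 1, ..., r are represented by 'I_r; the domain is exactly A. *)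
Notation coloring r A := {ffun {x | x \in A} -> 'I_r}.

Definition color_class (G : finZmodType) (r : nat) (A : {set G})
    (phi : coloring r A) (i : 'I_r) : {set G} :=
  [set val x | x : {x : G | x \in A} & phi x == i].

Definition sum_free_colorings (G : finZmodType) (r : nat) (A : {set G}) :
    {set coloring r A} :=
  [set phi | [forall i, sum_free (color_class phi i)]].

Definition kappa (G : finZmodType) (r : nat) (A : {set G}) : nat :=
  #|sum_free_colorings r A|.

Definition log2 (R : realType) (x : R) : R := ln x / ln 2.

Definition container_family (R : realType) (G : finZmodType) (A : {set G})
    (F : {set {set G}}) : Prop :=
  let n : R := #|G|%:R in
  [/\ forall X, X \in F -> X \subset A,
      log2 #|F|%:R <= n * (ln n `^ (- (1 / 18))),
      forall I : {set G}, I \subset A -> sum_free I ->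
        exists2 X, X \in F & I \subset X
    & forall X, X \in F ->
        #|schur_triples X|%:R <= n ^+ 2 * (ln n `^ (- (1 / 9)))].

(* The values of psi outside sum_free_colorings are irrelevant: see
   assigned_colorings. *)
Definition container_assignment (G : finZmodType) (r : nat) (A : {set G})
    (F : {set {set G}}) (psi : coloring r A -> {ffun 'I_r -> {set G}}) : Prop :=
  forall phi, phi \in sum_free_colorings r A ->
    forall i, psi phi i \in F /\ color_class phi i \subset psi phi i.

Definition assigned_colorings (G : finZmodType) (r : nat) (A : {set G})
    (psi : coloring r A -> {ffun 'I_r -> {set G}})
    (Fs : {ffun 'I_r -> {set G}}) : {set coloring r A} :=
  [set phi in sum_free_colorings r A | psi phi == Fs].

Definition symdiff (T : finType) (X Y : {set T}) : {set T} :=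
  (X :\: Y) :|: (Y :\: X).

Definition atom (T : finType) (t : nat) (B : 'I_t -> {set T})
    (eps : {ffun 'I_t -> bool}) : {set T} :=
  \bigcap_(i < t) (if eps i then B i else ~: B i).

(* The atom of eps is a k-atom when weight eps = k. *)
Definition weight (t : nat) (eps : {ffun 'I_t -> bool}) : nat :=
  (\sum_(i < t) eps i)%N.

(* finset.partition requires the blocks to be nonempty; hence distinct members
   of E give distinct blocks. *)
Definition consists_of_atoms (T : finType) (t : nat) (B : 'I_t -> {set T})
    (E : {set {ffun 'I_t -> bool}}) : bool :=
  partition [set atom B eps | eps in E] (\bigcup_(i < t) B i).

(* Main.v *)
Require Import Defs.
From mathcomp Require Import all_boot all_order all_algebra.
From mathcomp Require Import reals sequences exp.
From mathcomp Require Import lra zify.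

Set Implicit Arguments.
Unset Strict Implicit.
Unset Printing Implicit Defensive.

Import Order.TTheory GRing.Theory Num.Theory.
Local Open Scope ring_scope.

(* A set X with at least 21n/50 elements and few Schur triples contains, up to
   few elements, a sum-free set X' (the elements of X with few representations
   as a difference in X).  As |X'| > 2n/5, the difference set X' - X' has fewer
   than 3|X'|/2 elements, so it is a subgroup, of index 2, and X' lies in its
   nontrivial coset.  Hence every container is small or close to such a coset,
   and these cosets are largest sum-free sets.

   A tuple (F_1, ..., F_4) accounts for at most prod_x max(1, k(x)) colorings,
   where k(x) is the number of i with x in F_i.  From max(1, k) <= 3^(k/3) a
   small container makes this product too small, except in (a) when the other
   three containers are close to B; there k <= 3 + [x in F_i] on B suffices.

   In (b) let P be the set of x lying in an odd number of the four cosets; it is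
   empty or a coset itself.  The bound max(1, k) <= 2^(k/2) fails only at k = 3,
   so the product is at most about 2^n if P is empty.  If some
   x lies in exactly one coset, then so do n/16 elements, and the loss at k = 1
   compensates the gain at k = 3.  Otherwise every x in P misses exactly one
   coset, exactly two indices i, j are missed, and the two other cosets are
   equal to P, which is the symmetric difference of the cosets i and j. *)

(** * Character sets and sum-free sets *)

Section Groups.

Variable G : finZmodType.
Implicit Types (B S F : {set G}) (x y z : G).

(* A syntactically uniform form of max_card, on which lia can rely. *)
Let card_le S : (#|S| <= #|G|)%N. Proof. exact: max_card. Qed.

Definition translate x S : {set G} := [set x + s | s in S].

Lemma mem_translate x S z : (z \in translate x S) = (z - x \in S).
Proof.
apply/imsetP/idP => [[s sS ->]|zS]; first by rewrite addrC addKr.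
by exists (z - x) => //; rewrite addrC subrK.
Qed.

Lemma card_translate x S : #|translate x S| = #|S|.
Proof. by apply: card_imset; apply: addrI. Qed.

Lemma card_disjoint_translate x S :
  [disjoint translate x S & S] -> (#|S| + #|S| <= #|G|)%N.
Proof.
rewrite -setI_eq0 => /eqP xS0.
rewrite -{1}(card_translate x S) -cardsUI xS0 cards0 addn0.
exact: max_card.
Qed.

Lemma sum_freeP S :
  reflect (forall x y, x \in S -> y \in S -> x + y \notin S) (sum_free S).
Proof.
apply: (iffP eqP) => [S0 x y xS yS|freeS].
  apply/negP => xyS; have := in_set0 (x, y, x + y).
  by rewrite -S0 inE /= xS yS xyS eqxx.
apply/setP => -[[x y] z]; rewrite !inE /=; apply/negP.
by case/and4P => xS yS zS /eqP xyz; move: (freeS x y xS yS); rewrite xyz zS.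
Qed.

(** For [x] in [S], the translate [x + S] is disjoint from [S]. *)
Lemma card_sum_free S : sum_free S -> (#|S| + #|S| <= #|G|)%N.
Proof.
move=> /sum_freeP freeS; have [->|[x xS]] := set_0Vmem S; first by rewrite cards0.
apply: (@card_disjoint_translate x); rewrite -setI_eq0.
apply/eqP/setP => z; rewrite !inE mem_translate; apply/negP => /andP[zxS].
by apply/negP; rewrite -(subrK x z) freeS.
Qed.

(* B is the preimage of 1 under a homomorphism from G to Z/2. *)
Definition character_set B : Prop :=
  forall x y, (x + y \in B) = (x \in B) (+) (y \in B).

Lemma character_set0 B : character_set B -> 0 \notin B.
Proof. by move=> chB; have := chB 0 0; rewrite addr0 addbb => ->. Qed.

Lemma character_setN B x : character_set B -> (- x \in B) = (x \in B).
Proof.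
move=> chB; have := chB x (- x); rewrite subrr (negbTE (character_set0 chB)).
by case: (x \in B); case: (- x \in B).
Qed.

(** Translation by an element of [B] maps [B] onto its complement. *)
Lemma card_character_set B : character_set B -> B != set0 -> #|G| = (#|B|.*2)%N.
Proof.
move=> chB /set0Pn[b bB]; rewrite -addnn -{1}(card_translate b B) -(cardsC B) addnC.
congr (_ + _)%N; apply: eq_card => x.
by rewrite inE mem_translate chB character_setN // bB addbT.
Qed.

Lemma character_set_sum_free B : character_set B -> sum_free B.
Proof. by move=> chB; apply/sum_freeP => x y xB yB; rewrite chB xB yB. Qed.

Lemma character_set_largest B :
  character_set B -> B != set0 -> largest_sum_free B.
Proof.
move=> chB B0; rewrite /largest_sum_free character_set_sum_free //=.
apply/forallP => S; apply/implyP => /card_sum_free.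
by rewrite addnn (card_character_set chB B0) leq_double.
Qed.

(* Every difference of two elements of S is a difference in more than |S|/2
   ways, so S - S is closed under subtraction. *)
Lemma sum_free_character_set S :
  sum_free S -> (2 * #|G| < 5 * #|S|)%N ->
  exists B, [/\ character_set B, B != set0 & S \subset B].
Proof.
move=> /sum_freeP freeS largeS.
pose D : {set G} := [set x - y | x in S, y in S].
have memD x y : x \in S -> y \in S -> x - y \in D.
  by move=> xS yS; apply/imset2P; exists x y.
have SD : S \subset ~: D.
  apply/subsetP => z zS; rewrite inE; apply/negP => /imset2P[x y xS yS zxy].
  by move: (freeS z y zS yS); rewrite zxy subrK xS.
have cardSD : (#|S| + #|D| <= #|G|)%N.
  by rewrite -(cardsC D) addnC leq_add2l subset_leq_card.
have [s sS] : exists s, s \in S by apply/set0Pn; rewrite -card_gt0; lia.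
have D0 : 0 \in D by rewrite -(subrr s) memD.
pose base z := [set x in S | x - z \in S].
(* If [z = a - b], then [base z] is in bijection with the intersection of [S - a] and [S - b]. Both
   translates lie in [D], and [#|D| <= #|G| - #|S| < 3 * #|S| / 2]. *)
have card_base z : z \in D -> (#|S| < 2 * #|base z|)%N.
  case/imset2P => a b aS bS zab.
  have -> : #|base z| = #|translate (- a) S :&: translate (- b) S|.
    rewrite -(card_translate (- a)); apply: eq_card => w.
    rewrite !inE !mem_translate !inE !opprK zab.
    by rewrite opprB -addrA [a + _]addrC subrK.
  have sub c : c \in S -> translate (- c) S \subset D.
    move=> cS; apply/subsetP => w; rewrite mem_translate opprK => wS.
    by rewrite -(addrK c w) memD.
  have := cardsUI (translate (- a) S) (translate (- b) S).
  rewrite !card_translate.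
  have : (#|translate (- a) S :|: translate (- b) S| <= #|D|)%N.
    by rewrite subset_leq_card // subUset !sub.
  lia.
have DB z w : z \in D -> w \in D -> z - w \in D.
  move=> zD wD.
  have [x] : exists x, x \in base w :&: base z.
    apply/set0Pn; rewrite -card_gt0.
    have := cardsUI (base w) (base z); have := card_base _ zD.
    have := card_base _ wD.
    have : (#|base w :|: base z| <= #|S|)%N.
      by rewrite subset_leq_card // subUset; apply/andP; split;
         apply/subsetP => x; rewrite inE => /andP[].
    lia.
  rewrite !inE => /andP[/andP[xS xw] /andP[_ xz]].
  have -> : z - w = (x - w) - (x - z) by rewrite opprB [RHS]addrC subrKA.
  exact: memD.
have DN z : z \in D -> - z \in D by move=> zD; rewrite -sub0r DB.
have DD z w : z \in D -> w \in D -> z + w \in D.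
  by move=> zD wD; rewrite -[w]opprK DB // DN.
have cardD : (#|S| <= #|D|)%N.
  rewrite -(card_translate (- s)); apply/subset_leq_card/subsetP => w.
  by rewrite mem_translate opprK => wS; rewrite -(addrK s w) memD.
(* Otherwise [D], [z + D] and [- w + D] would be pairwise disjoint, whereas
   [3 * #|D| >= 3 * #|S| > #|G|]. *)
have NDD z w : z \notin D -> w \notin D -> z + w \in D.
  move=> zD wD; apply/negPn/negP => zwD.
  have d1 : D :&: translate z D = set0.
    apply/setP => x; rewrite !inE mem_translate; apply/negP => /andP[xD xz].
    by case/negP: zD; rewrite -[z](subKr x) DB.
  have d2 : (D :|: translate z D) :&: translate (- w) D = set0.
    apply/setP => x; rewrite !inE !mem_translate opprK; apply/negP => /andP[].
    case/orP => xD xw.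
      by case/negP: wD; rewrite -[w](addKr x) addrC DB.
    case/negP: zwD; have -> : z + w = (x + w) - (x - z).
      by rewrite opprB [x + w]addrC addrA addrAC addrK addrC.
    exact: DB.
  have := card_le ((D :|: translate z D) :|: translate (- w) D).
  have := cardsUI (D :|: translate z D) (translate (- w) D).
  have := cardsUI D (translate z D).
  rewrite d1 d2 cards0 !card_translate; lia.
exists (~: D); split => //; last first.
  by apply/set0Pn; exists s; apply: (subsetP SD).
move=> x y; rewrite !inE.
have [xD|xD] := boolP (x \in D); have [yD|yD] := boolP (y \in D) => /=.
- by rewrite DD.
- by apply/negP => xyD; case/negP: yD; rewrite -[y](addKr x) addrC DB.
- by apply/negP => xyD; case/negP: xD; rewrite -[x](addrK y) DB.
- by rewrite NDD.
Qed.

Lemma card_schur_triples F :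
  #|schur_triples F| = (\sum_(x in F) #|[set y in F | (x + y)%R \in F]|)%N.
Proof.
rewrite -sum1_card (eq_bigr (fun x => \sum_(y | (y \in F) && ((x + y)%R \in F)) 1))%N;
  last by move=> x _; rewrite -sum1_card; apply: eq_bigl => y; rewrite inE.
rewrite pair_big_dep /=.
rewrite (reindex_onto (fun p : G * G => (p.1, p.2, p.1 + p.2)) (fun t => t.1)) /=.
  by apply: eq_bigl => -[x y]; rewrite !inE /= !eqxx !andbT.
by move=> [[x y] z]; rewrite inE /= => /and4P[_ _ _ /eqP->].
Qed.

(* F' collects the x in F with few representations as a difference of elements
   of F; differences of elements of F' are popular, hence F' is sum-free. *)
Lemma few_schur_triples_character_set F :
  (21 * #|G| <= 50 * #|F|)%N ->
  (100 * 100 * #|schur_triples F| <= #|G| * #|G|)%N ->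
  exists B, [/\ character_set B, B != set0 &
    (#|F :\: B| * #|G| <= 100 * #|schur_triples F|)%N].
Proof.
move=> largeF fewT.
have n_gt0 : (0 < #|G|)%N by apply/card_gt0P; exists 0.
pose r x := #|[set y in F | x + y \in F]|.
pose F' : {set G} := [set x in F | (100 * r x <= #|G|)%N].
have rI x y : r (x - y) = #|translate x F :&: translate y F|.
  rewrite /r -[in LHS](card_translate x); apply: eq_card => w.
  rewrite !inE !mem_translate !inE; congr (_ && (_ \in F)).
  by rewrite addrC addrA subrK.
have r0 x : r x = #|translate x F :&: F|.
  rewrite -[in LHS](subr0 x) rI; apply: eq_card => w.
  by rewrite !inE !mem_translate subr0.
have F'F : F' \subset F by apply/subsetP => x; rewrite inE => /andP[].
(* Each element of [F] outside [F'] is the first entry of more than [#|G| / 100] Schur triples. *)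
have cardFF' : (#|F :\: F'| * #|G| <= 100 * #|schur_triples F|)%N.
  rewrite card_schur_triples big_distrr /= -sum_nat_const.
  rewrite [leqRHS](big_setID F') /= (setIidPr F'F).
  apply: leq_trans (leq_addl _ _); apply: leq_sum => x.
  by rewrite !inE; case: (x \in F) => //=; rewrite andbT -ltnNge => /ltnW.
(* For [x = z + y], the sets [x + F] and [y + F] each meet [F] in at most [#|G| / 100] elements. As
   all three have at least [21 * #|G| / 50] elements, [x + F] and [y + F] share at least
   [12 * #|G| / 50], too many for [z = x - y] to be in [F']. *)
have freeF' : sum_free F'.
  apply/sum_freeP => z y; rewrite !inE => /andP[zF rz] /andP[yF ry].
  apply/negP => /andP[xF rx]; move: rz; rewrite -[z](addrK y) rI leqNgt => /negP.
  apply; set x := z + y in xF rx *.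
  have := cardsUI (translate x F) (translate y F).
  have := cardsUI (translate x F :|: translate y F) F.
  have := card_le (translate x F :|: translate y F :|: F).
  have := (leq_card_setU (translate x F :&: F) (translate y F :&: F)).1.
  rewrite -setIUl !card_translate -!r0.
  move: largeF rx ry n_gt0.
  lia.
(* Here [21 / 50 - 1 / 100 > 2 / 5]. *)
have largeF' : (2 * #|G| < 5 * #|F'|)%N.
  have := cardsID F' F; rewrite (setIidPr F'F).
  have : (100 * #|F :\: F'| <= #|G|)%N.
    rewrite -(leq_pmul2r n_gt0); lia.
  lia.
have [B [chB B0 F'B]] := sum_free_character_set freeF' largeF'.
exists B; split=> //; apply: leq_trans cardFF'.
by rewrite leq_pmul2r // subset_leq_card // setDS.
Qed.

End Groups.

(** * Four character sets *)

Definition multiplicity (T : finType) (t : nat) (Fs : 'I_t -> {set T}) (x : T) :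
    nat :=
  #|[set i | x \in Fs i]|.

Lemma multiplicityE (T : finType) t (Fs : 'I_t -> {set T}) x :
  multiplicity Fs x = (\sum_(i < t) (x \in Fs i))%N.
Proof.
rewrite /multiplicity -sum1_card big_mkcond /=.
by apply: eq_bigr => i _; rewrite inE; case: (x \in Fs i).
Qed.

Lemma sum_multiplicity (T : finType) t (Fs : 'I_t -> {set T}) :
  (\sum_x multiplicity Fs x = \sum_(i < t) #|Fs i|)%N.
Proof.
under eq_bigr do rewrite multiplicityE.
rewrite exchange_big; apply: eq_bigr => i _.
by rewrite -sum1_card [RHS]big_mkcond; apply: eq_bigr => x _; case: (x \in Fs i).
Qed.

Lemma multiplicity_le (T : finType) t (Fs : 'I_t -> {set T}) x :
  (multiplicity Fs x <= t)%N.
Proof. by rewrite -[leqRHS](card_ord t) max_card. Qed.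

Section Characters.

Variables (G : finZmodType) (t : nat) (Bs : 'I_t -> {set G}).
Hypothesis chB : forall i, character_set (Bs i).

Definition odd_set : {set G} := [set x | odd (multiplicity Bs x)].

(** The parity of the multiplicity is a sum of homomorphisms to Z/2. *)
Lemma odd_set_character : character_set odd_set.
Proof.
have oddE x : (x \in odd_set) = \big[addb/false]_(i < t) (x \in Bs i).
  rewrite inE multiplicityE (big_morph odd oddD (erefl : odd 0 = false)).
  by apply: eq_bigr => i _; rewrite oddb.
by move=> x y; rewrite !oddE -big_split; apply: eq_bigr => i _; apply: chB.
Qed.

(* Two nonempty common level sets of the Bs are translates of each other, and
   there are at most 2^t of them. *)
Lemma card_level_set x :
  (#|G| <= 2 ^ t * #|[set y | [forall i, (y \in Bs i) == (x \in Bs i)]]|)%N.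
Proof.
set L := [set y | _].
pose sg y := [ffun i => y \in Bs i].
have sgE y z : sg y = sg z -> forall i, (y \in Bs i) = (z \in Bs i).
  by move=> /ffunP yz i; have := yz i; rewrite !ffunE.
rewrite -[leqLHS]sum1_card (partition_big sg predT) //=.
apply: (@leq_trans (\sum_(e : {ffun 'I_t -> bool}) #|L|)%N); last first.
  by rewrite sum_nat_const card_ffun card_bool card_ord.
apply: leq_sum => e _; rewrite sum1dep_card.
have [->|[y0]] := set_0Vmem [set y | sg y == e]; first by rewrite ?cards0.
rewrite inE => /eqP sgy0; rewrite -(card_translate (y0 - x) L).
apply/subset_leq_card/subsetP => y; rewrite inE => /eqP sgy.
rewrite mem_translate inE; apply/forallP => i.
have /sgE yy0 : sg y = sg y0 by rewrite sgy0.
by rewrite !chB !character_setN // chB character_setN // yy0; case: (_ \in _);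
   case: (_ \in _).
Qed.

End Characters.

Section FourCharacters.

Variables (G : finZmodType) (Bs : 'I_4 -> {set G}).
Hypotheses (chB : forall i, character_set (Bs i)) (B0 : forall i, Bs i != set0).

Let P := odd_set Bs.
Let chP : character_set P := odd_set_character chB.

Hypothesis no1 : forall x, multiplicity Bs x != 1%N.

(** The only odd number up to 4 other than 1 is 3. *)
Lemma missing_index x : x \in P -> exists c, forall i, (x \in Bs i) = (i != c).
Proof.
rewrite inE => oddx.
have x3 : multiplicity Bs x = 3%N.
  move: oddx (no1 x) (multiplicity_le Bs x); move: (multiplicity Bs x).
  by do 5 case=> //.
have : #|~: [set i | x \in Bs i]| == 1%N.
  have := cardsC [set i | x \in Bs i]; rewrite card_ord.
  by rewrite [#|[set i | _]|]x3 => /eqP; rewrite -[4%N]/(3 + 1)%N eqn_add2l.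
move=> /cards1P[c /setP cE]; exists c => i; have := cE i.
by rewrite !inE => <-; rewrite negbK.
Qed.

Let missed := [set i | ~~ (P \subset Bs i)].

Lemma missed_witness i :
  i \in missed -> exists2 x, x \in P & forall j, (x \in Bs j) = (j != i).
Proof.
rewrite inE => /subsetPn[x xP xBi]; exists x => //.
have [c cE] := missing_index xP.
by move: xBi; rewrite cE negbK => /eqP->.
Qed.

(** If three indices were missed, the sum of their witnesses would lie only in the set of the fourth
    index, against [no1]. *)
Lemma card_missed_le2 : (#|missed| <= 2)%N.
Proof.
rewrite leqNgt; apply/negP => /card_gt2P[i [j [l [[im jm lm] [ij jl li]]]]].
have [[x _ xE] [y _ yE] [z _ zE]] :=
  And3 (missed_witness im) (missed_witness jm) (missed_witness lm).
case/negP: (no1 (x + y + z)); rewrite /multiplicity; apply/eqP.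
have -> : [set m | x + y + z \in Bs m] = ~: [set i; j; l].
  apply/setP => m; rewrite !inE !chB xE yE zE.
  have [->|mi] := eqVneq m i; first by rewrite (negbTE ij) eq_sym (negbTE li).
  have [->|mj] := eqVneq m j; first by rewrite (negbTE jl).
  by case: eqVneq.
have := cardsC [set i; j; l]; rewrite card_ord setUC cardsU1 cards2 !inE ij.
by rewrite (negbTE li) eq_sym (negbTE jl) => -[].
Qed.

Hypothesis P0 : P != set0.

(** Both sets have exactly half the elements of [G], so inclusion is equality. *)
Lemma not_missed i : i \notin missed -> Bs i = P.
Proof.
rewrite inE negbK => PB; apply/esym/eqP; rewrite eqEcard PB /=.
rewrite -leq_double -(card_character_set (chB i)) //.
by rewrite -(card_character_set chP).
Qed.

(** If at most one index [i] is missed, the other three sets equal [P]. Modulo 2, membership in [P]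
    is then membership in [Bs i] plus three times membership in [P], which forces [Bs i] to be
    empty. *)
Lemma card_missed : #|missed| = 2%N.
Proof.
apply/eqP; rewrite eqn_leq card_missed_le2 ltnNge; apply/negP.
move=> le1; have [i iE] : exists i, forall j, j != i -> Bs j = P.
  have [m0|[i im]] := set_0Vmem missed.
    by exists ord0 => j _; rewrite not_missed // m0 inE.
  exists i => j ji; apply: not_missed; apply: contra ji => jm.
  by rewrite (card_le1_eqP le1 j i).
case/set0Pn: (B0 i) => x xB; have : (x \in P) = (x \in P) by [].
rewrite {1}inE multiplicityE (bigD1 i) //= (eq_bigr (fun=> nat_of_bool (x \in P))).
  by rewrite sum_nat_const cardC1 card_ord xB; case: (x \in P).
by move=> j ji; rewrite iE.
Qed.

(** The two sets that equal [P] cancel modulo 2, which leaves the symmetric difference of the two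
    missed ones. *)
Lemma odd_set_symdiff : exists i j, [/\ i != j, P = symdiff (Bs i) (Bs j),
   forall l, l != i -> l != j -> Bs l = P,
   (exists2 x, x \notin Bs i & x \in Bs j) &
   (exists2 x, x \in Bs i & x \notin Bs j)].
Proof.
have /eqP/cards2P[i [j [ij mE]]] := card_missed.
have lP l : l != i -> l != j -> Bs l = P.
  by move=> li lj; apply: not_missed; rewrite mE !inE negb_or li.
exists i, j; split=> //.
- apply/setP => x; rewrite {1}inE multiplicityE (bigD1 i) //= (bigD1 j) 1?eq_sym //=.
  rewrite (eq_bigr (fun=> nat_of_bool (x \in P))); last first.
    by move=> l /andP[li lj]; rewrite lP.
  rewrite sum_nat_const.
  have -> : #|[pred l | (l != i) && (l != j)]| = 2%N.
    have := cardsC [set i; j]; rewrite cards2 ij card_ord => -[cij]; apply: etrans cij.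
    by apply: eq_card => l; rewrite !inE negb_or.
  rewrite mul2n !oddD odd_double addbF !oddb !inE.
  by case: (x \in Bs i); case: (x \in Bs j).
- have [x _ xE] : exists2 x, x \in P & forall l, (x \in Bs l) = (l != i).
    by apply: missed_witness; rewrite mE !inE eqxx.
  by exists x; rewrite xE ?eqxx // eq_sym.
- have [x _ xE] : exists2 x, x \in P & forall l, (x \in Bs l) = (l != j).
    by apply: missed_witness; rewrite mE !inE eqxx orbT.
  by exists x; rewrite xE ?eqxx.
Qed.

End FourCharacters.

(** * Atoms of two sets and their symmetric difference *)

Lemma mem_atom (T : finType) t (B : 'I_t -> {set T}) e x :
  (x \in atom B e) = [forall i, (x \in B i) == e i].
Proof.
apply/bigcapP/forallP => [xB i|xB i _].
  by have := xB i isT; case: (e i) => [->//|]; rewrite inE => /negbTE->.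
by have /eqP := xB i; case: (e i) => xBi; rewrite ?inE xBi.
Qed.

Lemma weight_card t (e : {ffun 'I_t -> bool}) : weight e = #|[set i | e i]|.
Proof.
rewrite /weight -sum1_card [RHS]big_mkcond /=.
by apply: eq_bigr => i _; rewrite inE; case: (e i).
Qed.

(** An element of both [B i] and [B j] is in no other set, hence in a 2-atom; an element of just one
    of them is in both other sets, hence in a 3-atom. The three existence hypotheses make these
    atoms nonempty. *)
Lemma consists_of_symdiff_atoms (T : finType) (B : 'I_4 -> {set T}) (i j : 'I_4) :
  i != j -> (forall l, l != i -> l != j -> B l = symdiff (B i) (B j)) ->
  (exists x, x \in B i :&: B j) -> (exists2 x, x \notin B i & x \in B j) ->
  (exists2 x, x \in B i & x \notin B j) ->
  exists e e' e'' : {ffun 'I_4 -> bool},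
    [/\ weight e = 2%N, weight e' = 3%N, weight e'' = 3%N, e' != e''
      & consists_of_atoms B [set e; e'; e'']].
Proof.
move=> ij BE [x11 x11B] [x01 x01i x01j] [x10 x10i x10j].
pose e := [ffun l : 'I_4 => (l == i) || (l == j)].
pose e' := [ffun l : 'I_4 => l != j].
pose e'' := [ffun l : 'I_4 => l != i].
have atomE x : [/\ (x \in atom B e) = (x \in B i) && (x \in B j),
    (x \in atom B e') = (x \in B i) && (x \notin B j) &
    (x \in atom B e'') = (x \notin B i) && (x \in B j)].
  have ji : j != i by rewrite eq_sym.
  rewrite !mem_atom; split; apply/forallP/andP.
  - by move=> xB; move: (xB i) (xB j); rewrite !ffunE !eqxx orbT => /eqP-> /eqP->.
  - move=> [xi xj] l; rewrite ffunE.
    have [->|li] := eqVneq l i; first by rewrite xi.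
    have [->|lj] := eqVneq l j; first by rewrite xj.
    by rewrite BE // !inE xi xj.
  - by move=> xB; move: (xB i) (xB j); rewrite !ffunE eqxx ij => /eqP-> /eqP->.
  - move=> [xi xj] l; rewrite ffunE.
    have [->|lj] := eqVneq l j; first by rewrite (negbTE xj).
    have [->|li] := eqVneq l i; first by rewrite xi.
    by rewrite BE // !inE xi xj.
  - by move=> xB; move: (xB i) (xB j); rewrite !ffunE eqxx ji => /eqP-> /eqP->.
  - move=> [xi xj] l; rewrite ffunE.
    have [->|li] := eqVneq l i; first by rewrite (negbTE xi).
    have [->|lj] := eqVneq l j; first by rewrite xj.
    by rewrite BE // !inE xi xj.
exists e, e', e''; split.
- rewrite weight_card -(_ : [set i; j] = [set l | e l]) ?cards2 ?ij //.
  by apply/setP => l; rewrite !inE ffunE.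
- rewrite weight_card -(_ : [set~ j] = [set l | e' l]) ?cardsC1 ?card_ord //.
  by apply/setP => l; rewrite !inE ffunE.
- rewrite weight_card -(_ : [set~ i] = [set l | e'' l]) ?cardsC1 ?card_ord //.
  by apply/setP => l; rewrite !inE ffunE.
- by apply/eqP => /ffunP/(_ i); rewrite !ffunE ij eqxx.
rewrite /consists_of_atoms; apply/and3P; split.
- apply/eqP/setP => x; have [x1 x2 x3] := atomE x.
  apply/bigcupP/bigcupP => [[_ /imsetP[eps epsE ->]] xa|[l _ xl]].
    have : (x \in B i) || (x \in B j).
      move: epsE xa; rewrite !inE -orbA => /or3P[] /eqP-> ; rewrite ?x1 ?x2 ?x3.
      + by case/andP => ->.
      + by case/andP => ->.
      + by case/andP => _ ->; rewrite orbT.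
    by case/orP => xB; [exists i | exists j].
  have {l xl} xij : (x \in B i) || (x \in B j).
    have [li|li] := eqVneq l i; first by rewrite -li xl.
    have [lj|lj] := eqVneq l j; first by rewrite -lj xl orbT.
    by move: xl; rewrite BE // !inE => /orP[] /andP[_ ->]; rewrite ?orbT.
  have [xi|xi] := boolP (x \in B i); have [xj|xj] := boolP (x \in B j).
  + by exists (atom B e); rewrite ?x1 ?xi ?imset_f // !inE eqxx.
  + by exists (atom B e'); rewrite ?x2 ?xi ?imset_f // !inE eqxx orbT.
  + by exists (atom B e''); rewrite ?x3 ?xj ?xi ?imset_f // !inE eqxx orbT.
  + by move: xij; rewrite (negbTE xi) (negbTE xj).
- apply/trivIsetP => _ _ /imsetP[e1 _ ->] /imsetP[e2 _ ->].
  apply: contraR => /pred0Pn[x /andP[/= x1 x2]]; apply/eqP; congr (atom B).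
  apply/ffunP => l; move: x1 x2; rewrite !mem_atom.
  by move=> /forallP/(_ l)/eqP<- /forallP/(_ l)/eqP<-.
- apply/imsetP => -[eps]; rewrite !inE -orbA => epsE /setP a0.
  case/or3P: epsE a0 => /eqP-> a0.
  + have [x1 _ _] := atomE x11; move: x11B (a0 x11).
    by rewrite x1 !inE => ->.
  + by have [_ x2 _] := atomE x10; move: (a0 x10); rewrite x2 inE x10i x10j.
  + by have [_ _ x3] := atomE x01; move: (a0 x01); rewrite x3 inE x01i x01j.
Qed.

Lemma eq_consists_of_atoms (T : finType) t (B B' : 'I_t -> {set T}) E :
  B =1 B' -> consists_of_atoms B E = consists_of_atoms B' E.
Proof.
move=> BB'; congr partition; last exact: eq_bigr.
by apply: eq_imset => eps; apply: eq_bigr => i _; rewrite BB'.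
Qed.

(** * Counting colorings *)

(** Such a coloring gives [x] in [A] only colors [i] with [x] in [Fs i]; points outside [A]
    contribute a factor 1. *)
Lemma card_assigned_colorings (G : finZmodType) t (A : {set G})
    (F : {set {set G}}) (psi : coloring t A -> {ffun 'I_t -> {set G}}) Fs :
  container_assignment F psi ->
  (#|assigned_colorings psi Fs| <= \prod_x maxn (multiplicity Fs x) 1)%N.
Proof.
move=> psiF; pose C (x : {x | x \in A}) := [pred i : 'I_t | val x \in Fs i].
apply: (@leq_trans #|(family C : simpl_pred {ffun {x | x \in A} -> 'I_t})|).
  apply/subset_leq_card/subsetP => phi; rewrite inE => /andP[phiA /eqP psiE].
  apply/familyP => x; rewrite inE -psiE.
  have [_ /subsetP sub] := psiF phi phiA (phi x).
  by apply: sub; apply/imsetP; exists x; rewrite ?inE.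
rewrite card_family foldrE big_map big_enum /=.
rewrite (eq_bigr (fun x : {x | x \in A} => multiplicity Fs (val x))); last first.
  by move=> x _; apply: eq_card => i; rewrite !inE.
rewrite -(big_sub _ (fun x => multiplicity Fs x)) big_mkcond.
by apply: leq_prod => x _; case: ifP => _; rewrite ?leq_maxl ?leq_maxr.
Qed.

(** * Explicit inequalities between logarithms *)

Section Logarithms.

Variable R : realType.

Lemma ln_natr_prod (I : finType) (f : I -> nat) :
  (forall i, (0 < f i)%N) ->
  ln (\prod_i f i)%N%:R = \sum_i ln (f i)%:R :> R.
Proof.
move=> f0; suff [] : (0 < \prod_i f i)%N /\
  ln (\prod_i f i)%N%:R = \sum_i ln (f i)%:R :> R by [].
elim/big_ind2: _ => [|a b c d [a0 <-] [c0 <-]|i _]; rewrite ?ln1 //.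
by rewrite muln_gt0 a0 c0 natrM lnM // posrE ltr0n.
Qed.

(** This reduces the inequalities below to comparing explicit rational powers, such as
    [2 ^ 11 = 2048] and [3 ^ 7 = 2187]. With a single base on the left, [y] is 1 and [b] is 0. *)
Lemma ln_pow_le (x y z : R) a b c : 0 < x -> 0 < y -> 0 < z ->
  x ^+ a * y ^+ b <= z ^+ c -> a%:R * ln x + b%:R * ln y <= c%:R * ln z.
Proof.
move=> x0 y0 z0; rewrite !mulr_natl -!lnXn // -lnM ?posrE ?exprn_gt0 //.
by move=> le; rewrite ler_ln ?posrE ?mulr_gt0 ?exprn_gt0.
Qed.

Lemma ln2_le_ln3 : 11 * ln 2 <= 7 * ln 3 :> R.
Proof. by have := @ln_pow_le 2 1 3 11 0 7; rewrite !expr0; lra. Qed.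

Lemma ln3_le_ln21_5 : 9 * ln 3 <= 7 * ln (21 / 5) :> R.
Proof. by have := @ln_pow_le 3 1 (21/5) 9 0 7; lra. Qed.

Lemma ln3_ln2_le_ln21_5 : 21 * ln 3 + 16 * ln 2 <= 24 * ln (21 / 5) :> R.
Proof. by have := @ln_pow_le 3 2 (21/5) 21 16 24; lra. Qed.

Lemma ln3_le_ln3999 : 5 * ln 3 <= 4 * ln (3999 / 1000) :> R.
Proof. by have := @ln_pow_le 3 1 (3999/1000) 5 0 4; lra. Qed.

Lemma ln3_ln2_le_ln3999 : 3 * ln 3 + 25 * ln 2 <= 15 * ln (3999 / 1000) :> R.
Proof. by have := @ln_pow_le 3 2 (3999/1000) 3 25 15; lra. Qed.

(** The square of [7 / 5 + 14 / 1000 = 1.414] is below 2. Part (b) is proved with [21 / 5] in place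
    of its threshold. *)
Lemma threshold_ge : 42 / 10 <= 3 * Num.sqrt 2 - 1 / 25 :> R.
Proof.
have : 7 / 5 + 14 / 1000 <= Num.sqrt 2 :> R; last by lra.
rewrite -[leLHS]ger0_norm; last by lra.
by rewrite -sqrtr_sqr ler_sqrt; lra.
Qed.

End Logarithms.

(** * Bounds on the logarithm of the number of colorings *)

Section RealBounds.

Variable R : realType.

(* An element in no Fs i has no admissible color, but counts with a factor 1
   when it lies outside A. *)
Definition log_colors (k : nat) : R := ln (maxn k 1)%:R.

Lemma log_colors_small : [/\ log_colors 0 = 0, log_colors 1 = 0,
  log_colors 2 = ln 2, log_colors 3 = ln 3 & log_colors 4 = 2 * ln 2].
Proof.
rewrite /log_colors /= !ln1; split=> //.
by rewrite -[maxn 4 1]/(2 * 2)%N natrM lnM ?posrE //; lra.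
Qed.

Lemma ln2_gt0 : 0 < ln 2 :> R. Proof. by apply: ln_gt0; lra. Qed.

Lemma log_colors_ge0 k : 0 <= log_colors k.
Proof. by apply: ln_ge0; rewrite ler1n leq_maxr. Qed.

Lemma log_colors_mono k l : (k <= l)%N -> log_colors k <= log_colors l.
Proof.
move=> kl; rewrite ler_ln ?posrE ?ltr0n ?leq_max ?orbT // ler_nat geq_max leq_maxr.
by rewrite leq_max kl.
Qed.

(** Among positive integers, [k ^ (1 / k)] is largest at [k = 3]. *)
Lemma log_colors_le_ln3 k : (k <= 4)%N -> 3 * log_colors k <= k%:R * ln 3.
Proof.
have [e0 e1 e2 e3 e4] := log_colors_small; have := ln2_le_ln3 R; have := ln2_gt0.
by move: k => [|[|[|[|[|k]]]]] // l20 l32 _; rewrite ?e0 ?e1 ?e2 ?e3 ?e4; lra.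
Qed.

(** Both sides agree for all these [k]: the parity term is the excess at 3, and the last term
    corrects it at 1. This form sums to a linear expression in the sizes of the sets, of [odd_set]
    and of the set of points of multiplicity 1. *)
Lemma log_colors_le_parity k : (k <= 4)%N ->
  2 * log_colors k <= k%:R * ln 2 + (odd k)%:R * (2 * ln 3 - 3 * ln 2)
    - (k == 1%N)%:R * (2 * (ln 3 - ln 2)).
Proof.
have [e0 e1 e2 e3 e4] := log_colors_small; have := ln2_le_ln3 R; have := ln2_gt0.
by move: k => [|[|[|[|[|k]]]]] // l20 l32 _; rewrite ?e0 ?e1 ?e2 ?e3 ?e4 /=; lra.
Qed.

Lemma sum_indicator (T : finType) (S : {set T}) :
  \sum_x (x \in S)%:R = #|S|%:R :> R.
Proof.
rewrite -sum1_card natr_sum [RHS]big_mkcond /=.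
by apply: eq_bigr => x _; case: (x \in S).
Qed.

Lemma sum_multiplicityR (T : finType) t (Fs : 'I_t -> {set T}) :
  \sum_x (multiplicity Fs x)%:R = \sum_i #|Fs i|%:R :> R.
Proof. by rewrite -!natr_sum sum_multiplicity. Qed.

Section Multiplicity.

Variables (T : finType) (Fs : 'I_4 -> {set T}).

Lemma sum_log_colors_le_ln3 :
  3 * (\sum_x log_colors (multiplicity Fs x)) <= (\sum_i #|Fs i|%:R) * ln 3.
Proof.
rewrite -sum_multiplicityR mulr_sumr mulr_suml; apply: ler_sum => x _.
by rewrite log_colors_le_ln3 // multiplicity_le.
Qed.

(** A point in no [Fs i :\: Bs i] has no larger multiplicity in [Fs] than in [Bs]. Any other point
    is counted at least once in the error term, and contributes at most [ln 4]. *)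
Lemma sum_log_colors_le_approx (Bs : 'I_4 -> {set T}) :
  \sum_x log_colors (multiplicity Fs x) <=
  \sum_x log_colors (multiplicity Bs x)
    + (\sum_i #|Fs i :\: Bs i|%:R) * (2 * ln 2).
Proof.
rewrite -(sum_multiplicityR (fun i => Fs i :\: Bs i)) mulr_suml -big_split /=.
apply: ler_sum => x _; set b := multiplicity (fun i => Fs i :\: Bs i) x.
have le : (multiplicity Fs x <= multiplicity Bs x + b)%N.
  rewrite /b !multiplicityE -big_split /=; apply: leq_sum => i _.
  by rewrite inE; case: (x \in Fs i); case: (x \in Bs i).
have l20 := ln2_gt0.
case: b le => [|b] le.
  by rewrite mul0r addr0 log_colors_mono // -[leqRHS]addn0.
have := log_colors_mono (multiplicity_le Fs x).
have [_ _ _ _ ->] := log_colors_small.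
have := log_colors_ge0 (multiplicity Bs x).
have : 0 <= b%:R * ln 2 :> R by rewrite mulr_ge0 // ltW.
by rewrite -natr1; lra.
Qed.

End Multiplicity.

Lemma ln_assigned_colorings (G : finZmodType) (A : {set G})
    (F : {set {set G}}) (psi : coloring 4 A -> {ffun 'I_4 -> {set G}}) Fs :
  container_assignment F psi ->
  ln #|assigned_colorings psi Fs|%:R <=
    \sum_x log_colors (multiplicity Fs x) :> R.
Proof.
move=> psiF; have := card_assigned_colorings Fs psiF.
(* The default value [ln 0 = 0] settles the case of no coloring. *)
have [->|c0] := posnP #|assigned_colorings psi Fs|.
  by rewrite ln0 // sumr_ge0 // => x _; rewrite log_colors_ge0.
rewrite -ln_natr_prod => [|x]; last by rewrite leq_maxr.
by move=> le; rewrite ler_ln ?posrE ?ltr0n ?(leq_trans c0 le) // ler_nat.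
Qed.

Lemma card_character_setR (G : finZmodType) (B : {set G}) :
  character_set B -> B != set0 -> #|B|%:R = #|G|%:R / 2 :> R.
Proof.
by move=> chB /(card_character_set chB) ->; rewrite -mul2n natrM; lra.
Qed.

Section Characters.

Variables (G : finZmodType) (Bs : 'I_4 -> {set G}).
Hypotheses (chB : forall i, character_set (Bs i)) (B0 : forall i, Bs i != set0).
Let n : R := #|G|%:R.

(** In the second case, [odd_set Bs] has [n / 2] elements and at least [n / 16] points have
    multiplicity 1, which gives exactly this bound. If [odd_set Bs] is empty, the sum is at most
    [n * ln 2], and [11 * ln 2 <= 7 * ln 3]. *)
Lemma sum_log_colors_character :
  odd_set Bs = set0 \/ (exists x, multiplicity Bs x = 1%N) ->
  \sum_x log_colors (multiplicity Bs x) <= n * (7 * ln 3 + 5 * ln 2) / 16.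
Proof.
move=> bad.
pose ones : {set G} := [set x | multiplicity Bs x == 1%N].
have le : 2 * (\sum_x log_colors (multiplicity Bs x)) <=
    (\sum_i #|Bs i|%:R) * ln 2 + #|odd_set Bs|%:R * (2 * ln 3 - 3 * ln 2)
      - #|ones|%:R * (2 * (ln 3 - ln 2)).
  rewrite -sum_multiplicityR -!sum_indicator mulr_sumr !mulr_suml -big_split /=.
  rewrite -sumrB; apply: ler_sum => x _; rewrite !inE.
  by rewrite log_colors_le_parity // multiplicity_le.
have sB : \sum_i #|Bs i|%:R = n * 2.
  rewrite (eq_bigr (fun=> n / 2)) => [|i _]; last exact: card_character_setR.
  by rewrite sumr_const card_ord -mulr_natr; lra.
have n0 : 0 <= n by [].
have l20 := ln2_gt0; have l32 := ln2_le_ln3 R.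
have ones0 : 0 <= #|ones|%:R :> R by [].
have [P0|P0] := eqVneq (odd_set Bs) set0.
  have : 0 <= #|ones|%:R * (ln 3 - ln 2) :> R by rewrite mulr_ge0 //; lra.
  by move: le; rewrite sB P0 cards0; have := ler_wpM2l n0 l32; lra.
have [x x1] : exists x, multiplicity Bs x = 1%N.
  by case: bad => // P0'; rewrite P0' eqxx in P0.
have cP := card_character_setR (odd_set_character chB) P0.
have c1 : n <= 16 * #|ones|%:R.
  rewrite -natrM ler_nat; apply: leq_trans (card_level_set chB x) _.
  rewrite leq_mul2l /=; apply/subset_leq_card/subsetP => y; rewrite !inE.
  move=> /forallP yx; apply/eqP; apply: etrans x1; apply: eq_card => i.
  by rewrite !inE; apply/eqP.
have l23 : 0 <= ln 3 - ln 2 :> R by lra.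
by move: le; rewrite sB cP; have := ler_wpM2r l23 c1; lra.
Qed.

End Characters.

Lemma sum4_le1 (a : 'I_4 -> R) i0 u w : a i0 <= u -> (forall i, a i <= w) ->
  \sum_i a i <= u + 3 * w.
Proof.
move=> ai0 aw; rewrite (bigD1 i0) //= lerD //.
apply: le_trans (ler_sum _ (fun i _ => aw i)) _.
by rewrite sumr_const cardC1 card_ord mulr_natl.
Qed.

Lemma sum4_le2 (a : 'I_4 -> R) i0 i1 u w : i0 != i1 -> a i0 <= u -> a i1 <= u ->
  (forall i, a i <= w) -> \sum_i a i <= 2 * u + 2 * w.
Proof.
move=> i01 ai0 ai1 aw; rewrite (bigD1 i0) //= (bigD1 i1) 1?eq_sym //=.
have : \sum_(i | (i != i0) && (i != i1)) a i <= 2 * w.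
  apply: le_trans (ler_sum _ (fun i _ => aw i)) _.
  rewrite sumr_const mulr_natl.
  have -> // : #|[pred l | (l != i0) && (l != i1)]| = 2%N.
  have := cardsC [set i0; i1]; rewrite cards2 i01 card_ord => -[c2].
  by apply: etrans c2; apply: eq_card => l; rewrite !inE negb_or.
lra.
Qed.

Lemma small_powers : exists n0 : nat, forall n : nat, (n0 <= n)%N ->
  let L : R := ln n%:R in
  [/\ 0 < L `^ (- (1 / 27)), L `^ (- (1 / 18)) <= 1 / 1000,
      L `^ (- (1 / 9)) <= 1 / 1000 / 1000 &
      100 * L `^ (- (1 / 9)) < 3 * L `^ (- (1 / 27))].
Proof.
(* Once [ln n >= c ^+ 18], the power with exponent [- (1 / 18)] is at most [1 / c]. The other two
   bounds follow from [u ^+ 3 = d = v ^+ 2]. *)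
pose c : R := 1000; have c0 : 0 < c by rewrite /c; lra.
exists (Num.truncn (expR (c ^+ 18))).+1 => n n0n L.
have LK : c ^+ 18 <= L.
  rewrite -[leLHS]expRK ler_ln ?posrE ?expR_gt0 //.
    by apply: le_trans (ltW (truncnS_gt _)) _; rewrite ler_nat.
  by rewrite ltr0n (leq_trans _ n0n).
have K0 : 0 < c ^+ 18 by rewrite exprn_gt0.
have L0 : 0 < L := lt_le_trans K0 LK.
set u := L `^ (- (1 / 27)); set v := L `^ (- (1 / 18)); set d := L `^ (- (1 / 9)).
have u0 : 0 < u by rewrite powR_gt0.
have v0 : 0 < v by rewrite powR_gt0.
have v2 : v ^+ 2 = d.
  by rewrite -powR_mulrn ?(ltW v0) // -powRrM; congr (_ `^ _); lra.
have u3 : u ^+ 3 = d.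
  by rewrite -powR_mulrn ?(ltW u0) // -powRrM; congr (_ `^ _); lra.
have v1 : v <= 1 / c.
  rewrite /v powRN [leRHS]div1r lef_pV2 ?posrE ?powR_gt0 //.
  have -> : c = (c ^+ 18) `^ (1 / 18).
    rewrite -powR_mulrn ?(ltW c0) // -powRrM.
    by rewrite (_ : _ * _ = 1) ?powRr1 ?(ltW c0) //; lra.
  by rewrite ge0_ler_powR // ?nnegrE ?(ltW K0) ?(ltW L0) //; lra.
have d1 : d <= 1 / 1000 / 1000.
  apply: (@le_trans _ _ ((1 / c) ^+ 2)); last by rewrite /c; lra.
  by rewrite -v2 lerXn2r ?nnegrE ?divr_ge0 // ltW.
have u1 : u <= 1 / 100.
  rewrite -(@ler_pXn2r _ 3) ?nnegrE ?(ltW u0) //; last by lra.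
  by rewrite u3; lra.
split=> //.
(* Dividing by [u] leaves [100 * u ^+ 2 < 3]. *)
rewrite -u3 exprSr mulrA ltr_pM2r //.
have : u ^+ 2 <= (1 / 100) ^+ 2 by rewrite lerXn2r ?nnegrE ?(ltW u0) //; lra.
lra.
Qed.

End RealBounds.

(** * Containers *)

Section Containers.

Variable R : realType.

Lemma container_dichotomy (G : finZmodType) (X : {set G}) (d : R) :
  #|schur_triples X|%:R <= #|G|%:R ^+ 2 * d -> d <= 1 / 1000 / 1000 ->
  #|X|%:R <= 21 / 50 * #|G|%:R :> R \/
  exists B, [/\ character_set B, B != set0 &
    #|X :\: B|%:R <= 100 * d * #|G|%:R].
Proof.
move=> fewT d1.
have n0 : 0 < #|G|%:R :> R by rewrite ltr0n; apply/card_gt0P; exists 0.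
have [lt|le] := ltnP (50 * #|X|) (21 * #|G|); [left | right].
  by move: lt; rewrite -(ltr_nat R) !natrM; lra.
have [|B [chB B0 XB]] := few_schur_triples_character_set le.
  rewrite -(ler_nat R) !natrM; move: fewT; rewrite expr2.
  have nn0 := mulr_ge0 (ltW n0) (ltW n0).
  by have := ler_wpM2l nn0 d1; lra.
exists B; split=> //; rewrite -(ler_pM2r n0).
move: XB; rewrite -(ler_nat R) !natrM => XB.
by apply: le_trans XB _; move: fewT; rewrite expr2; lra.
Qed.

Section Bounds.

Variables (G : finZmodType) (Fs : 'I_4 -> {set G}).
Let n : R := #|G|%:R.

Lemma card_le_approx (X B : {set G}) :
  #|X|%:R <= #|X :\: B|%:R + #|B|%:R :> R.
Proof.
by rewrite -natrD ler_nat addnC -(cardsID B X) leq_add2r subset_leq_card // subsetIr.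
Qed.

(** The slack [8 / 1000 * ln 2] pays for the number of container tuples, at most
    [2 ^ (4 * n / 1000)]. Two small containers make the total size at most [1.842 * n], and
    [log_colors_le_ln3] suffices; with one, the others are replaced by [B]. *)
Lemma sum_log_colors_unique (B : {set G}) i0 :
  #|B|%:R <= n / 2 ->
  (forall i, #|Fs i|%:R <= 21 / 50 * n \/ #|Fs i :\: B|%:R <= n / 1000) ->
  #|Fs i0|%:R <= 21 / 50 * n ->
  \sum_x log_colors R (multiplicity Fs x)
    <= n / 2 * (ln (3999 / 1000) - 8 / 1000 * ln 2).
Proof.
move=> cB FB Fi0.
have n0 : 0 <= n by [].
have l20 := ln2_gt0 R; have nl20 := mulr_ge0 n0 (ltW l20).
have l32 := ln2_le_ln3 R; have h5 := ln3_le_ln3999 R; have h6 := ln3_ln2_le_ln3999 R.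
set V := ln (3999 / 1000) in h5 h6 *; clearbody V.
have [/existsP[i1 /andP[i10 Fi1]]|one] :=
    boolP [exists i1, (i1 != i0) && (#|Fs i1|%:R <= 21 / 50 * n)].
  have le : \sum_i #|Fs i|%:R <= 2 * (21 / 50 * n) + 2 * (501 / 1000 * n).
    apply: (sum4_le2 i10) => // i.
    have [|FBi] := FB i; first by lra.
    by have := card_le_approx (Fs i) B; lra.
  have := sum_log_colors_le_ln3 R Fs.
  have : (\sum_i #|Fs i|%:R) * ln 3 <= (1842 / 1000 * n) * ln 3.
    by rewrite ler_wpM2r //; lra.
  by have := ler_wpM2l n0 h5; have := ler_wpM2l n0 l32; lra.
(* Keeping [Fs i0] itself at index [i0] makes the error there zero. *)
pose Bs i := if i == i0 then Fs i0 else B.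
have bad i : #|Fs i :\: Bs i|%:R <= n / 1000.
  rewrite /Bs; have [->|ii0] := eqVneq i i0.
    by rewrite setDv cards0 divr_ge0.
  have [Fi|//] := FB i; case/existsP: one; exists i; rewrite ii0.
  exact: Fi.
have sumbad : \sum_i #|Fs i :\: Bs i|%:R <= 3 * (n / 1000).
  have := @sum4_le1 R (fun i => #|Fs i :\: Bs i|%:R) i0 0 (n / 1000).
  by rewrite add0r; apply=> //; rewrite /Bs eqxx setDv cards0.
apply: le_trans (sum_log_colors_le_approx _ Fs Bs) _.
have : \sum_x log_colors R (multiplicity Bs x)
    <= #|B|%:R * ln 3 + #|Fs i0|%:R * (2 * ln 2 - ln 3).
  rewrite -!sum_indicator !mulr_suml -big_split /=; apply: ler_sum => x _.
  have -> : multiplicity Bs x = ((x \in Fs i0) + 3 * (x \in B))%N.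
    rewrite multiplicityE (bigD1 i0) //= {1}/Bs eqxx.
    rewrite (eq_bigr (fun=> nat_of_bool (x \in B))).
      by rewrite sum_nat_const cardC1 card_ord.
    by move=> i /negbTE ii0; rewrite /Bs ii0.
  have [e0 e1 e2 e3 e4] := log_colors_small R.
  case: (x \in Fs i0); case: (x \in B);
    rewrite ?muln0 ?muln1 ?addn0 ?add0n ?[(1 + 3)%N]/4%N ?e0 ?e1 ?e3 ?e4 /=.
  - by lra.
  - have := @ln_pow_le R 3 1 2 1 0 2; rewrite !expr0; lra.
  - by lra.
  - by lra.
have l34 : 0 <= 2 * ln 2 - ln 3 :> R.
  by have := @ln_pow_le R 3 1 2 1 0 2; rewrite !expr0; lra.
have l30 : 0 <= ln 3 :> R by lra.
have := ler_wpM2r l30 cB; have := ler_wpM2r l34 Fi0.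
have := ler_wpM2r (ltW l20) sumbad; have := ler_wpM2l n0 h6.
by have := ler_wpM2l n0 l32; lra.
Qed.

(** The total size is at most [1.923 * n], and [2 * 1.923 / 3 < 9 / 7]. *)
Lemma sum_log_colors_small_container i0 :
  #|Fs i0|%:R <= 21 / 50 * n -> (forall i, #|Fs i|%:R <= 501 / 1000 * n) ->
  \sum_x log_colors R (multiplicity Fs x) <= n / 2 * ln (21 / 5).
Proof.
move=> Fi0 Fi; have n0 : 0 <= n by [].
have l20 := ln2_gt0 R; have nl20 := mulr_ge0 n0 (ltW l20).
have l32 := ln2_le_ln3 R; have nl32 := ler_wpM2l n0 l32.
have h2 := ln3_le_ln21_5 R.
have le := sum4_le1 Fi0 Fi.
have := sum_log_colors_le_ln3 R Fs.
have : (\sum_i #|Fs i|%:R) * ln 3 <= (1923 / 1000 * n) * ln 3.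
  by rewrite ler_wpM2r //; lra.
by have := ler_wpM2l n0 h2; lra.
Qed.

Lemma sum_log_colors_close_characters (Bs : 'I_4 -> {set G}) :
  (forall i, character_set (Bs i)) -> (forall i, Bs i != set0) ->
  (forall i, #|Fs i :\: Bs i|%:R <= n / 1000) ->
  odd_set Bs = set0 \/ (exists x, multiplicity Bs x = 1%N) ->
  \sum_x log_colors R (multiplicity Fs x) <= n / 2 * ln (21 / 5).
Proof.
move=> chB B0 FB bad; have n0 : 0 <= n by [].
apply: le_trans (sum_log_colors_le_approx _ Fs Bs) _.
have := sum_log_colors_character R chB B0 bad.
have l20 := ln2_gt0 R; rewrite -/n.
have := ler_wpM2r (ltW l20) (sum4_le1 (FB ord0) FB).
have : 0 <= n * ln 2 by rewrite mulr_ge0 // ltW.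
by have := ler_wpM2l n0 (ln3_ln2_le_ln21_5 R); lra.
Qed.

End Bounds.

Lemma kappa_le (G : finZmodType) t (A : {set G}) (F : {set {set G}})
    (psi : coloring t A -> {ffun 'I_t -> {set G}}) (y : R) :
  container_assignment F psi -> 0 <= y ->
  (forall Fs, Fs \in ffun_on (mem F) -> #|assigned_colorings psi Fs|%:R <= y) ->
  (kappa t A)%:R <= #|F|%:R ^+ t * y.
Proof.
move=> psiF y0 le; rewrite /kappa -sum1_card.
rewrite (partition_big psi [in ffun_on (mem F)]) /=; last first.
  by move=> phi phiA; apply/ffun_onP => i; have [] := psiF phi phiA i.
rewrite natr_sum.
apply: (@le_trans _ _ (\sum_(Fs in ffun_on (mem F)) y)).
  apply: ler_sum => Fs FsF; apply: le_trans (le Fs FsF).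
  rewrite ler_nat -sum1_card; apply/eq_leq/eq_bigl => phi.
  by rewrite [RHS]inE.
by rewrite sumr_const card_ffun_on card_ord -natrX mulr_natl.
Qed.

End Containers.

Theorem theorem2p5 (R : realType) :
  exists n0 : nat,
  forall (G : finZmodType) (A : {set G}) (F : {set {set G}})
         (psi : coloring 4 A -> {ffun 'I_4 -> {set G}}),
    let n : R := #|G|%:R in
    ~~ odd #|G| -> (n0 <= #|G|)%N ->
    container_family R A F -> container_assignment F psi ->
    (forall B : {set G},
       (forall B' : {set G}, largest_sum_free B' <-> B' = B) ->
       (3999 / 1000) ^+ (#|G|./2) < (kappa 4 A)%:R :> R ->
       #|A :\: B|%:R < 12 * n * (ln n `^ (- (1 / 27))))
    /\
    ((exists B B' : {set G},
        [/\ largest_sum_free B, largest_sum_free B' & B != B']) ->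
     forall Fs : {ffun 'I_4 -> {set G}},
       (forall i, Fs i \in F) ->
       (3 * Num.sqrt 2 - 1 / 25) ^+ (#|G|./2)
         < #|assigned_colorings psi Fs|%:R :> R ->
       exists (B1 B2 B3 : {set G}) (f : 'I_4 -> 'I_3),
         let B := tnth [tuple B1; B2; B3] in
         [/\ [/\ largest_sum_free B1, largest_sum_free B2 & largest_sum_free B3],
             B3 = symdiff B1 B2,
             forall i, #|Fs i :\: B (f i)|%:R < 3 * n * (ln n `^ (- (1 / 27)))
           & exists e e' e'' : {ffun 'I_4 -> bool},
               [/\ weight e = 2%N, weight e' = 3%N, weight e'' = 3%N, e' != e''
                 & consists_of_atoms (fun i => B (f i)) [set e; e'; e'']]]).
Proof.
have [n0 n0P] := small_powers R.
exists n0 => G A F psi n evenG nn0 [FA Fcard _ FT] psiF.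
have [u0 v1 d1 du] := n0P _ nn0.
rewrite -/n in u0 v1 d1 du FT Fcard.
set u := _ `^ _ in u0 du *; set v := _ `^ _ in v1 Fcard; set d := _ `^ _ in d1 du FT.
have n_gt0 : 0 < n by rewrite ltr0n; apply/card_gt0P; exists 0.
have half (z : R) : 0 < z -> ln (z ^+ #|G|./2) = n / 2 * ln z.
  move=> z0; rewrite lnXn // -[LHS]mulr_natl; congr (_ * _).
  by rewrite /n -{2}(even_halfK evenG) -mul2n natrM; lra.
have dich X (XF : X \in F) := container_dichotomy (FT X XF) d1.
(* The first bound is for the conclusion, the second for the counting estimates. *)
have close (X B : {set G}) : #|X :\: B|%:R <= 100 * d * n ->
    #|X :\: B|%:R < 3 * n * u /\ #|X :\: B|%:R <= n / 1000.
  move=> XB; split.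
    by apply: le_lt_trans XB _; rewrite [X in _ < X]mulrAC ltr_pM2r.
  by apply: le_trans XB _; have := ler_wpM2l (ltW n_gt0) d1; lra.
split.
  move=> B uniqB; rewrite ltNge => kA; rewrite ltNge; apply/negP => AB.
  case/negP: kA.
  have /andP[freeB _] : largest_sum_free B by apply/uniqB.
  have cB : #|B|%:R <= n / 2.
    by have := card_sum_free freeB; rewrite -(ler_nat R) natrD -/n; lra.
  have dichB X : X \in F -> #|X|%:R <= 21 / 50 * n \/ #|X :\: B|%:R <= 100 * d * n.
    move=> XF; have [|[B' [chB' B'0 XB']]] := dich X XF; first by left.
    by right; rewrite -(proj1 (uniqB B') (character_set_largest chB' B'0)).
  set y := n / 2 * (ln (3999 / 1000) - 8 / 1000 * ln 2).
  have le : (kappa 4 A)%:R <= #|F|%:R ^+ 4 * expR y.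
    apply: (kappa_le psiF (expR_ge0 y)) => Fs /ffun_onP FsF.
    have [a0|/set0Pn[phi]] := eqVneq (assigned_colorings psi Fs) set0.
      by rewrite a0 cards0 expR_ge0.
    move=> phiFs; have a0 : (0 < #|assigned_colorings psi Fs|)%N.
      by apply/card_gt0P; exists phi.
    move: phiFs; rewrite inE => /andP[phiA /eqP psiE].
    (* If no container is small, all four are close to [B]. They cover [A], since each point lies in
       the container of its color, so [#|A :\: B|] is below [4 * (3 * n * u)], against [AB]. *)
    have [/existsP[i0 Fi0]|big] := boolP [exists i, #|Fs i|%:R <= 21 / 50 * n].
      rewrite -[leLHS]lnK ?posrE ?ltr0n // ler_expR.
      apply: le_trans (ln_assigned_colorings _ _ psiF) _.
      apply: (sum_log_colors_unique cB _ Fi0) => i.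
      have [|FB] := dichB _ (FsF i); first by left.
      by right; have [] := close _ _ FB.
    have FB i : #|Fs i :\: B|%:R < 3 * n * u.
      have [Fi|FB] := dichB _ (FsF i); last by have [] := close _ _ FB.
      by case/existsP: big; exists i; exact: Fi.
    have : #|A :\: B|%:R <= \sum_i #|Fs i :\: B|%:R :> R.
      rewrite -natr_sum -sum_multiplicity -sum1_card big_mkcond ler_nat.
      apply: leq_sum => x _; case: ifP => //; rewrite inE => /andP[xB xA].
      apply/card_gt0P; exists (phi (exist _ x xA)); rewrite !inE xB /= -psiE.
      have [_ /subsetP] := psiF phi phiA (phi (exist _ x xA)); apply.
      by apply/imsetP; exists (exist _ x xA); rewrite ?inE.
    have := sum4_le1 (lexx _) (fun i => ltW (FB i)).
    by move=> /(_ ord0); have := FB ord0; lra.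
  have [->|k0] := posnP (kappa 4 A); first by rewrite exprn_ge0 //; lra.
  have F0 : 0 < #|F|%:R :> R.
    rewrite lt0r ler0n andbT; apply/eqP => F0; move: le.
    by rewrite F0 expr0n mul0r lern0 gtn_eqF.
  have lnF : ln #|F|%:R <= n * v * ln 2.
    by rewrite -ler_pdivrMr ?ln2_gt0.
  have V0 : 0 < 3999 / 1000 :> R by lra.
  rewrite -ler_ln ?posrE ?ltr0n ?exprn_gt0 // half //.
  apply: (@le_trans _ _ (ln (#|F|%:R ^+ 4 * expR y))).
    by rewrite ler_ln ?posrE ?ltr0n ?mulr_gt0 ?exprn_gt0 ?expR_gt0.
  rewrite lnM ?posrE ?exprn_gt0 ?expR_gt0 // lnXn // expRK /y.
  have := ler_wpM2r (ltW (ln2_gt0 R)) (ler_wpM2l (ltW n_gt0) v1).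
  by move: lnF; set V := ln (3999 / 1000); clearbody V; lra.
move=> _ Fs FsF big.
have a0 : (0 < #|assigned_colorings psi Fs|)%N.
  rewrite -(ltr_nat R); apply: le_lt_trans big; rewrite exprn_ge0 //.
  by have := threshold_ge R; lra.
have {big} big : n / 2 * ln (21 / 5) < \sum_x log_colors R (multiplicity Fs x).
  apply: lt_le_trans (ln_assigned_colorings _ Fs psiF).
  rewrite -half; last by lra.
  rewrite ltr_ln ?posrE ?ltr0n //; last by rewrite exprn_gt0 //; lra.
  apply: le_lt_trans big; rewrite lerXn2r ?nnegrE //; have := threshold_ge R; lra.
have w i : #|Fs i|%:R <= 501 / 1000 * n.
  have [|[B [chB B0 XB]]] := dich _ (FsF i); first by lra.
  have [_] := close _ _ XB; have := card_le_approx R (Fs i) B.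
  by rewrite (card_character_setR R chB B0) -/n; lra.
have nosmall i : ~ (#|Fs i|%:R <= 21 / 50 * n).
  move=> /sum_log_colors_small_container /(_ w); rewrite leNgt => /negP; apply.
  exact: big.
have : forall i, exists B, [/\ character_set B, B != set0 &
    #|Fs i :\: B|%:R <= 100 * d * n].
  by move=> i; have [/nosmall|] := dich _ (FsF i).
case/fin_all_exists => Bs BsP.
have chB i : character_set (Bs i) by have [] := BsP i.
have B0 i : Bs i != set0 by have [] := BsP i.
have FBs i : #|Fs i :\: Bs i|%:R <= 100 * d * n by have [] := BsP i.
have good : ~ (odd_set Bs = set0 \/ (exists x, multiplicity Bs x = 1%N)).
  move=> /(sum_log_colors_close_characters chB B0 (fun i => (close _ _ (FBs i)).2)).
  by rewrite leNgt big.
have P0 : odd_set Bs != set0 by apply/eqP => P0; apply: good; left.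
have no1 x : multiplicity Bs x != 1%N by apply/eqP => x1; apply: good; right; exists x.
have [i [j [ij PE lP x01 x10]]] := odd_set_symdiff chB B0 no1 P0.
(* The missed indices [i] and [j] go to the first and second set, the other two to the third, which
   is [odd_set Bs]. *)
pose f (l : 'I_4) : 'I_3 :=
  if l == i then ord0 else if l == j then lift ord0 ord0 else ord_max.
have fB l : tnth [tuple Bs i; Bs j; odd_set Bs] (f l) = Bs l.
  rewrite /f; have [->//|li] := eqVneq l i.
  by have [->//|lj] := eqVneq l j; rewrite (lP l li lj).
(* The sum of a point only in [Bs j] and a point only in [Bs i], among these two, lies in both. *)
have x11 : exists x, x \in Bs i :&: Bs j.
  case: x01 x10 => [x xi xj] [y yi yj]; exists (x + y).
  by rewrite inE !chB (negbTE xi) xj yi (negbTE yj).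
have BE l : l != i -> l != j -> Bs l = symdiff (Bs i) (Bs j).
  by move=> li lj; rewrite lP.
have [e [e' [e'' [we we' we'' ee']]]] := consists_of_symdiff_atoms ij BE x11 x01 x10.
exists (Bs i), (Bs j), (odd_set Bs), f; split=> //.
- by split; apply: character_set_largest => //; apply: odd_set_character.
- by move=> l; rewrite fB; have [] := close _ _ (FBs l).
exists e, e', e''; split=> //.
by rewrite (eq_consists_of_atoms _ fB).
Qed.
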